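(* (1) For any $k\ge 1$, $m\ge 2$ and any $\rho\in\Delta_{k-1}^\circ$, the Riemannian metric $g^{\rho,m}$ on $(\Delta_{m-1}^k)^\circ$ satisfies $$g^{\rho,m}=\overline f^{*}(g^{\rho',n})\quad\text{for }\rho'=\rho R,$$ for any conditional embedding $\overline f:(\Delta_{m-1}^k)^\circ\to(\Delta_{n-1}^l)^\circ$, $K\mapsto\overline R^\top(K\otimes Q)$, and any $k\times l$ stochastic partition matrix $R$ with the same block structure as $\overline R$. (2) Conversely, suppose that for any $k\ge 1$, $m\ge 2$ and any $\rho\in\Delta_{k-1}^\circ$ there is a Riemannian metric $g^{(\rho,m)}$ on $(\Delta_{m-1}^k)^\circ$ such that $$g^{(\rho,m)}=\overline f^{*}(g^{(\rho',n)})\quad\text{for }\rho'=\rho R$$ holds for all conditional embeddings $\overline f: K\mapsto\overline R^\top(K\otimes Q)$ and all stochastic partition matrices $R$ with the same block structure as $\overline R$, and suppose that $g^{(\rho,m)}$ depends continuously on $\rho$. Then there is a constant $A>0$ such that $g^{(\rho,m)}=A\,g^{\rho,m}$ for all $k\geq 1$, $m\geq 2$ and $\rho\in\Delta_{k-1}^\circ$.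
   Context: $\Delta_{k-1}^\circ$ is the set of strictly positive probability vectors in $\mathbb{R}^k$ (written as row vectors, so $\rho R$ is a vector–matrix product). $(\Delta_{m-1}^k)^\circ$ is the set of $k\times m$ matrices with strictly positive entries all of whose rows sum to $1$; its tangent vectors at any point are the real $k\times m$ matrices $u$ with $\sum_b u_{ab}=0$ for all $a$. Weighted product Fisher metric: for $\rho\in\Delta_{k-1}^\circ$, $g^{\rho,m}$ is the metric on $(\Delta_{m-1}^k)^\circ$ given by $$g^{\rho,m}_K(u,v)=\sum_{a=1}^k\rho(a)\sum_{b=1}^m\frac{u_{ab}v_{ab}}{K_{ab}}.$$ Stochastic partition matrix: a matrix $Q\in\mathbb{R}^{m\times n}$ with non-negative entries such that there is a partition $\{A_1,\dots,A_m\}$ of $\{1,\dots,n\}$ into $m$ (non-empty) blocks with $\sum_{j\in A_{i'}}Q_{ij}=\delta_{ii'}$ for all $i,i'$; here its entries $Q_{ij}$ with $j\in A_i$ are strictly positive (as needed for the maps and vectors above to be strictly positive). Partition indicator matrix: a matrix $\overline R\in\{0,1\}^{k\times l}$ such that there is a partition $\{A_1,\dots,A_k\}$ of $\{1,\dots,l\}$ into $k$ (non-empty) blocks with $\overline R_{ij}=1$ if $j\in A_i$ and $\overline R_{ij}=0$ otherwise. A $k\times l$ stochastic partition matrix $R$ has the same block structure as $\overline R$ if $\overline R$ is obtained from $R$ by replacing all non-zero entries by one. Row product: for $K\in\mathbb{R}^{k\times m}$ and a collection $Q=\{Q^{(1)},\dots,Q^{(k)}\}$ of $m\times n$ matrices,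 $K\otimes Q$ is the $k\times n$ matrix with $(K\otimes Q)_{ab}=(K\cdot Q^{(a)})_{ab}$. Conditional embedding: given a $k\times l$ partition indicator matrix $\overline R$ and a collection $Q=\{Q^{(i)}\}_{i=1}^k$ of $m\times n$ stochastic partition matrices, the map $\overline f(K)=\overline R^\top(K\otimes Q)$; it maps $(\Delta_{m-1}^k)^\circ$ to $(\Delta_{n-1}^l)^\circ$. $\overline f^{*}g'$ denotes the pull-back metric $(\overline f^{*}g')_K(u,v)=g'_{\overline f(K)}(\overline f_*u,\overline f_*v)$. *)

(* Defs.v *)
From HB Require Import structures.
From mathcomp Require Import all_boot all_order all_algebra.
From mathcomp Require Import all_classical all_reals all_analysis.
From mathcomp Require Import ring.

Set Implicit Arguments.
Unset Strict Implicit.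
Unset Printing Implicit Defensive.

Import Order.TTheory GRing.Theory Num.Theory.
Import numFieldNormedType.Exports.

Local Open Scope classical_set_scope.
Local Open Scope ring_scope.

Section Polytopes.
Variable R : realType.

Definition open_simplex (k : nat) : set 'rV[R]_k :=
  [set rho | (forall a, 0 < rho ord0 a) /\ \sum_a rho ord0 a = 1].

Definition open_cond_polytope (k m : nat) : set 'M[R]_(k, m) :=
  [set K | (forall a b, 0 < K a b) /\ (forall a, \sum_b K a b = 1)].

Definition tangent (k m : nat) : set 'M[R]_(k, m) :=
  [set u | forall a, \sum_b u a b = 0].

End Polytopes.

Arguments open_simplex {R} k _.
Arguments open_cond_polytope {R} k m _.
Arguments tangent {R} {k m} _.

Section RiemannianMetrics.
Variable R : realType.

(* A tensor field [g K u v] is total; only its values at [K] in the open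
   polytope and [u], [v] tangent are meaningful. *)
Definition tensor (k m : nat) :=
  'M[R]_(k, m) -> 'M[R]_(k, m) -> 'M[R]_(k, m) -> R.

(* [iter_derive [:: u1; ...; ur] F = 'D_u1 (... ('D_ur F))].  For tangent [ui]
   and [K] in the open polytope, its value at [K] depends only on the values of
   [F] on the open polytope, which is relatively open in an affine space with
   direction [tangent]. *)
Definition iter_derive (k m : nat) (s : seq 'M[R]_(k, m))
    (F : 'M[R]_(k, m) -> R) : 'M[R]_(k, m) -> R :=
  foldr (fun u G => fun K => 'D_u G K) F s.

(* C^oo on the open polytope: all iterated tangential directional derivatives
   exist and are continuous. *)
Definition smooth_on_polytope (k m : nat) (F : 'M[R]_(k, m) -> R) : Prop :=
  forall s : seq 'M[R]_(k, m), (forall u, u \in s -> tangent u) ->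
    {within open_cond_polytope k m, continuous (iter_derive s F)} /\
    (forall K u, open_cond_polytope k m K -> tangent u ->
       derivable (iter_derive s F) K u).

Definition riemannian_metric (k m : nat) (g : tensor k m) : Prop :=
  [/\ forall K, open_cond_polytope k m K ->
        forall (c : R) u1 u2 v, tangent u1 -> tangent u2 -> tangent v ->
        g K (c *: u1 + u2) v = c * g K u1 v + g K u2 v,
      forall K, open_cond_polytope k m K ->
        forall u v, tangent u -> tangent v -> g K u v = g K v u,
      forall K, open_cond_polytope k m K ->
        forall u, tangent u -> u != 0 -> 0 < g K u u
    & forall u v, tangent u -> tangent v ->
        smooth_on_polytope (fun K => g K u v)].

Definition eq_metric (k m : nat) (g h : tensor k m) : Prop :=
  forall K u v, open_cond_polytope k m K -> tangent u -> tangent v ->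
    g K u v = h K u v.

(* ['D_u f K] is the pushforward of the tangent vector [u] at [K] along [f]. *)
Definition pullback (k m l n : nat) (f : 'M[R]_(k, m) -> 'M[R]_(l, n))
    (g : tensor l n) : tensor k m :=
  fun K u v => g (f K) ('D_u f K) ('D_v f K).

Definition fisher (k m : nat) (rho : 'rV[R]_k) : tensor k m :=
  fun K u v => \sum_a rho ord0 a * \sum_b u a b * v a b / K a b.

End RiemannianMetrics.

Section Embeddings.
Variable R : realType.

Definition indexed_partition (k l : nat) (A : 'I_k -> {set 'I_l}) : Prop :=
  injective A /\ finset.partition [set A i | i : 'I_k]%SET [set: 'I_l]%SET.

(* The block entries are required to be strictly positive, so that the matrix
   maps positive vectors to positive vectors. *)
Definition stochastic_partition_mx (m n : nat) (Q : 'M[R]_(m, n)) : Prop :=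
  (forall i j, 0 <= Q i j) /\
  exists A : 'I_m -> {set 'I_n},
    [/\ indexed_partition A,
        forall i i', \sum_(j in A i') Q i j = (i == i')%:R
      & forall i j, j \in A i -> 0 < Q i j].

Definition partition_indicator_mx (k l : nat) (Rbar : 'M[R]_(k, l)) : Prop :=
  exists A : 'I_k -> {set 'I_l},
    indexed_partition A /\ forall i j, Rbar i j = (j \in A i)%:R.

Definition same_block_structure (k l : nat) (S Rbar : 'M[R]_(k, l)) : Prop :=
  Rbar = map_mx (fun x => (x != 0)%:R) S.

Definition row_product (k m n : nat) (K : 'M[R]_(k, m))
    (Q : 'I_k -> 'M[R]_(m, n)) : 'M[R]_(k, n) :=
  \matrix_(a, b) (K *m Q a) a b.

Definition cond_embedding (k m l n : nat) (Rbar : 'M[R]_(k, l))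
    (Q : 'I_k -> 'M[R]_(m, n)) (K : 'M[R]_(k, m)) : 'M[R]_(l, n) :=
  Rbar^T *m row_product K Q.

(* [S] refines the row distribution [rho]; [l] and [n] are otherwise constrained
   only by the existence of the partitions, which forces [k <= l], [m <= n]. *)
Definition invariant_family
    (g : forall k m : nat, 'rV[R]_k -> tensor R k m) : Prop :=
  forall (k m l n : nat) (rho : 'rV[R]_k) (Rbar S : 'M[R]_(k, l))
      (Q : 'I_k -> 'M[R]_(m, n)),
    (1 <= k)%N -> (2 <= m)%N -> open_simplex k rho ->
    partition_indicator_mx Rbar ->
    (forall a, stochastic_partition_mx (Q a)) ->
    stochastic_partition_mx S -> same_block_structure S Rbar ->
    eq_metric (g k m rho) (pullback (cond_embedding Rbar Q) (g l n (rho *m S))).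

End Embeddings.

Section FisherRiemannian.
Variable R : realType.

Definition inv_power_sum (k m p : nat) (c K : 'M[R]_(k, m)) : R :=
  \sum_a \sum_b c a b * (K a b)^-1 ^+ p.

Lemma near_line_polytope (k m : nat) (K u : 'M[R]_(k, m)) :
  open_cond_polytope k m K -> tangent u ->
  \forall h \near (0 : R), open_cond_polytope k m (h *: u + K).
Proof.
move=> [K0 K1] u0.
have E (i : 'I_k * 'I_m) : \forall h \near (0 : R), 0 < (h *: u + K) i.1 i.2.
  have : (fun h : R => (h *: u + K) i.1 i.2) @ (0 : R) -->
      0 * u i.1 i.2 + K i.1 i.2.
    under eq_fun do rewrite !mxE.
    apply: (@cvgD _ _ _ _ _ (fun h : R => h * u i.1 i.2)
      (fun=> K i.1 i.2)); last exact: cvg_cst.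
    by apply: cvgM; [exact: cvg_id|exact: cvg_cst].
  rewrite mul0r add0r => /cvgr_gt; apply; exact: K0.
have : \forall h \near (0 : R), forall i : 'I_k * 'I_m,
    0 < (h *: u + K) i.1 i.2.
  exact: (@filter_forall R ('I_k * 'I_m)%type
    (fun i h => 0 < (h *: u + K) i.1 i.2) (nbhs (0 : R)) _ E).
apply: filterS => h H; split => [a b|a]; first exact: (H (a, b)).
under eq_bigr do rewrite !mxE.
by rewrite big_split /= -mulr_sumr u0 mulr0 add0r K1.
Qed.

Lemma is_derive_inv_power_sum (k m p : nat) (c K u : 'M[R]_(k, m))
    (G : 'M[R]_(k, m) -> R) :
  {in open_cond_polytope k m, G =1 inv_power_sum p c} ->
  open_cond_polytope k m K -> tangent u ->
  is_derive K u G
    (inv_power_sum p.+1 (\matrix_(a, b) (- p%:R * u a b * c a b)) K).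
Proof.
move=> GE PK tu.
set l := (X in is_derive _ _ _ X).
have D1 : is_derive (0 : R) 1 (fun h : R => G (h *: u + K)) l.
  have L : is_derive (0 : R) 1
    (\sum_a \sum_b (fun h : R => c a b * (h * u a b + K a b)^-1 ^+ p)) l.
    apply: is_derive_sum => a; apply: is_derive_sum => b.
    have nz : 0 * u a b + K a b != 0.
      by rewrite mul0r add0r gt_eqF // (PK.1 a b).
    have d1 : is_derive (0 : R) 1 (fun h : R => h * u a b + K a b) (u a b).
      have -> : (fun h : R => h * u a b + K a b) = (u a b \*: id) + cst (K a b).
        by apply/funext => h /=; rewrite /= [RHS]/GRing.add/= mulrC.
      apply: is_derive_eq; by rewrite addr0 scaler1.
    have d2 : is_derive (0 : R) 1 (fun h : R => (h * u a b + K a b)^-1)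
        (- (0 * u a b + K a b) ^- 2 *: u a b).
      split; first exact: derivableV.
      by rewrite deriveV // derive_val.
    have := is_deriveZ (c a b) (is_deriveX p d2).
    move=> d3.
    have -> : (fun h : R => c a b * (h * u a b + K a b)^-1 ^+ p) =
        c a b \*: ((fun h : R => (h * u a b + K a b)^-1) ^+ p).
      by apply/funext => h /=; rewrite exprfctE.
    apply: (is_derive_eq d3).
    rewrite mul0r add0r !mxE /=; have K0 := gt_eqF (PK.1 a b).
    rewrite /GRing.scale /=; case: p {l d2 d3 GE} => [|p].
      by rewrite !mul0r oppr0 !mul0r ?mulr0.
    by rewrite /= ?exprS ?expr0 ?mulr1 invfM; ring.
  have near_eq : \forall h \near (0 : R),
     (\sum_a \sum_b (fun h : R => c a b * (h * u a b + K a b)^-1 ^+ p)) h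
       = G (h *: u + K).
    near=> h; have Ph : open_cond_polytope k m (h *: u + K).
      by near: h; exact: near_line_polytope.
    rewrite GE ?inE // /inv_power_sum fct_sumE; apply: eq_bigr => a _.
    by rewrite fct_sumE; apply: eq_bigr => b _; rewrite !mxE.
  by apply: (@near_eq_is_derive R R R
    (\sum_a \sum_b (fun h : R => c a b * (h * u a b + K a b)^-1 ^+ p))
    (fun h : R => G (h *: u + K)) 0 1 l _ L); exact: near_eq.
have dG : derivable G K u by apply/derivable1P; case: D1.
split=> //; case: D1 => _ <-.
rewrite /derive; set g1 := fun h => h^-1 *: _; set g2 := fun h => h^-1 *: _.
suff -> : g1 = g2 by [].
apply/funext => h; rewrite /g1 /g2 /=.
by rewrite addr0 scale0r add0r [_%:A]mulr1.
Unshelve. all: by end_near.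
Qed.

Lemma iter_derive_inv_power_sum (k m : nat) (c : 'M[R]_(k, m)) p s
    (F : 'M[R]_(k, m) -> R) :
  (forall u, u \in s -> tangent u) ->
  {in open_cond_polytope k m, F =1 inv_power_sum p c} ->
  exists q d, {in open_cond_polytope k m,
    iter_derive s F =1 inv_power_sum q d}.
Proof.
move=> ts FE; elim: s ts => [|u s IH] ts; first by exists p, c.
have [|q [d E]] := IH; first by move=> v vs; apply: ts; rewrite inE vs orbT.
exists q.+1, (\matrix_(a, b) (- q%:R * u a b * d a b)) => K; rewrite inE => PK.
have tu : tangent u by apply: ts; rewrite inE eqxx.
by have [_ <-] := is_derive_inv_power_sum E PK tu.
Qed.

Lemma continuous_inv_power_sum (k m p : nat) (c K : 'M[R]_(k, m)) :
  open_cond_polytope k m K -> {for K, continuous (inv_power_sum p c)}.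
Proof.
move=> [K0 _]; apply: (@cvg_big _ _ _ _ _ _ _ (nbhs K)) => [|a _].
  exact: add_continuous.
apply: (@cvg_big _ _ _ _ _ _ _ (nbhs K)) => [|b _].
  exact: add_continuous.
apply: cvgM; first exact: cvg_cst.
apply: (@cvg_comp _ _ _ (fun K : 'M[R]_(k, m) => (K a b)^-1)
  (fun x : R => x ^+ p)); last exact: exprn_continuous.
by apply: cvgV; [rewrite gt_eqF|exact: coord_continuous].
Qed.

Lemma fisher_riemannian (k m : nat) (rho : 'rV[R]_k) :
  open_simplex k rho -> riemannian_metric (@fisher R k m rho).
Proof.
move=> [rho0 _]; split.
- move=> K _ c u1 u2 v _ _ _; rewrite /fisher mulr_sumr -big_split /=.
  apply: eq_bigr => a _; rewrite mulrCA -mulrDr; congr (_ * _).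
  rewrite mulr_sumr -big_split /=; apply: eq_bigr => b _.
  by rewrite !mxE; ring.
- move=> K _ u v _ _; apply: eq_bigr => a _; congr (_ * _).
  by apply: eq_bigr => b _; rewrite [u a b * _]mulrC.
- move=> K [K0 _] u _; apply: contra_neqT; rewrite -leNgt => le0.
  have ge (a : 'I_k) (b : 'I_m) : 0 <= u a b * u a b / K a b.
    by rewrite divr_ge0 -?expr2 ?sqr_ge0 // ltW.
  have ge2 (a : 'I_k) : 0 <= rho ord0 a * \sum_b u a b * u a b / K a b.
    by rewrite mulr_ge0 ?sumr_ge0 // ltW.
  have /eqP : fisher rho K u u = 0.
    by apply/eqP; rewrite eq_le le0 sumr_ge0.
  rewrite psumr_eq0 // => /allP z; apply/matrixP => a b; rewrite mxE.
  have /eqP := z a (mem_index_enum _); move/eqP.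
  rewrite mulf_eq0 gt_eqF //= psumr_eq0 // => /allP /(_ b (mem_index_enum _)).
  by rewrite !mulf_eq0 invr_eq0 (gt_eqF (K0 _ _)) orbF orbb => /eqP.
- move=> u v _ _ s ts.
  have FE : {in open_cond_polytope k m, (fun K => fisher rho K u v) =1
      inv_power_sum 1 (\matrix_(a, b) (rho ord0 a * (u a b * v a b)))}.
    move=> K _; apply: eq_bigr => a _; rewrite mulr_sumr.
    by apply: eq_bigr => b _; rewrite mxE expr1 !mulrA.
  have [q [d E]] := iter_derive_inv_power_sum ts FE; split.
    apply: (@subspace_eq_continuous _ _ _ (inv_power_sum q d)).
      by move=> K PK; exact/esym/E.
    apply: continuous_in_subspaceT => K; rewrite inE.
    exact: continuous_inv_power_sum.
  by move=> K w PK tw; have [] := is_derive_inv_power_sum E PK tw.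
Qed.

End FisherRiemannian.

(* Main.v *)
Require Import Defs.
From mathcomp Require Import all_boot all_order all_algebra fingroup perm.
From mathcomp Require Import all_classical all_reals all_analysis.
From mathcomp Require Import ring lra.
Import Order.TTheory GRing.Theory Num.Theory.
Import numFieldNormedType.Exports.
Local Open Scope classical_set_scope.
Local Open Scope ring_scope.

(** A stochastic partition matrix is a map [h] of column indices to row indices
    with positive weights summing to one on each fibre of [h], so a conditional
    embedding splits every entry of [K] into weighted pieces; the Fisher metric
    is preserved because [(u w) (v w) / (K w) = (u v / K) w].

    Conversely, at uniform [rho] and uniform [K] the permutation embeddings make
    [g] invariant under permuting the rows and, independently, the entries of
    each row, which forces [g = c (fisher rho)]; uniform refinements show that
    [c] depends on neither [k] nor [m].  A rational pair [(rho, K)] is mapped to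
    a uniform one by splitting each entry into as many equal pieces as its
    numerator over a common denominator.  Continuity in [K], then in [rho],
    gives the general case. *)

(** * Conditional embeddings as weighted index maps; invariance of the Fisher metric *)

Section Embeddings.
Set Implicit Arguments.
Unset Strict Implicit.
Variable R : realType.

(** The blocks of a partition are encoded as the fibres of [h]; since the weights on each fibre sum
    to one, no fibre is empty. *)
Definition fibre_weights (m n : nat) (h : 'I_n -> 'I_m) (w : 'I_n -> R) :=
  (forall j, 0 < w j) /\ (forall i, \sum_(j | h j == i) w j = 1).

Lemma fibre_inhabited (m n : nat) (h : 'I_n -> 'I_m) (w : 'I_n -> R) i :
  fibre_weights h w -> exists j, h j = i.
Proof.
move=> [_ w1]; have [j /eqP hj|none] := pickP (fun j => h j == i).
  by exists j.
by have /eqP := w1 i; rewrite big_pred0 // eq_sym oner_eq0.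
Qed.

Lemma sum_fibres (m n : nat) (h : 'I_n -> 'I_m) (w : 'I_n -> R)
    (F : 'I_m -> R) :
  fibre_weights h w -> \sum_j F (h j) * w j = \sum_i F i.
Proof.
move=> [_ w1]; rewrite (partition_big h xpredT) //=; apply: eq_bigr => i _.
rewrite -[RHS]mulr1 -(w1 i) mulr_sumr.
by apply: eq_bigr => j /eqP ->.
Qed.

Lemma indexed_partition_fibres (m n : nat) (h : 'I_n -> 'I_m) (w : 'I_n -> R) :
  fibre_weights h w -> Defs.indexed_partition (fun i => [set j | h j == i]%SET).
Proof.
move=> hw; split=> [i i' /setP eqii|].
  have [j hj] := fibre_inhabited i hw.
  by have := eqii j; rewrite !inE hj eqxx => /esym/eqP.
apply/and3P; split.
- apply/eqP/setP => j; rewrite finset.in_setT; apply/bigcupP.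
  by exists [set j' | h j' == h j]%SET; rewrite ?imset_f // inE.
- apply/finset.trivIsetP => _ _ /imsetP[i _ ->] /imsetP[i' _ ->] nii.
  rewrite -finset.setI_eq0; apply/eqP/setP => j; rewrite !inE.
  by apply/negP => /andP[/eqP hi /eqP hi']; rewrite -hi -hi' eqxx in nii.
- apply/negP => /imsetP[i _ /setP e]; have [j hj] := fibre_inhabited i hw.
  by have := e j; rewrite !inE hj eqxx.
Qed.

(** Every column lies in exactly one block, so one row index and one weight per column determine the
    matrix. *)
Lemma stochastic_partition_mxP (m n : nat) (Q : 'M[R]_(m, n)) :
  stochastic_partition_mx Q <->
  exists h w, fibre_weights h w /\ forall i j, Q i j = (h j == i)%:R * w j.
Proof.
split=> [[Q0 [A [[injA partA] sumA posA]]]|].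
  have /and3P[/eqP covA /finset.trivIsetP trivA _] := partA.
  have /choice[h hA] : forall j, exists i, j \in A i.
    move=> j; have : j \in finset.cover [set A i | i : 'I_m]%SET.
      by rewrite covA finset.in_setT.
    by move=> /bigcupP[_ /imsetP[i _ ->]]; exists i.
  have hE i j : (j \in A i) = (h j == i).
    apply/idP/eqP => [ji|<-//]; apply/eqP/contraT => nij.
    have /disjointFr/(_ (hA j)) : [disjoint A (h j) & A i]%B.
      by apply: trivA; rewrite ?imset_f //; apply: contra_neq nij => /injA.
    by rewrite ji.
  (* Off its block, an entry is a nonnegative term of a sum equal to zero. *)
  have QE i j : Q i j = (h j == i)%:R * Q (h j) j.
    case: eqVneq => [->|nij]; first by rewrite mul1r.
    have := sumA i (h j); rewrite eq_sym (negPf nij) => /eqP.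
    rewrite psumr_eq0 // => /allP/(_ j (mem_index_enum _)).
    by rewrite mul0r hA => /eqP.
  exists h, (fun j => Q (h j) j); split=> //; split=> [j|i]; first exact: posA.
  have <- : \sum_(j in A i) Q i j = 1 by rewrite sumA eqxx.
  by apply: eq_big => [j|j /eqP ->//]; rewrite hE.
move=> [h [w [hw QE]]]; have [w0 w1] := hw; split=> [i j|].
  by rewrite QE mulr_ge0 // ltW.
exists (fun i => [set j | h j == i]%SET); split=> [|i i'|i j].
- exact: indexed_partition_fibres hw.
- under eq_bigl do rewrite inE.
  under eq_bigr => j /eqP hj do rewrite QE hj eq_sym.
  by rewrite -mulr_sumr w1 mulr1.
- by rewrite inE QE => ->; rewrite mul1r.
Qed.

Section Refinement.
Variables (k m l n : nat) (al : 'I_l -> 'I_k) (be : 'I_k -> 'I_n -> 'I_m).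
Variables (s : 'I_l -> R) (w : 'I_k -> 'I_n -> R).

(** Closed form of a conditional embedding: [al] and [be] name the block of each row and column
    index, the column partition depending on the source row. The weights [s] act on the row
    distribution. *)
Definition refine_mx (K : 'M[R]_(k, m)) : 'M[R]_(l, n) :=
  \matrix_(j, b) (K (al j) (be (al j) b) * w (al j) b).

Definition refine_row (rho : 'rV[R]_k) : 'rV[R]_l :=
  \row_j (rho ord0 (al j) * s j).

Lemma cond_embeddingE (Rbar : 'M[R]_(k, l)) (Q : 'I_k -> 'M[R]_(m, n)) :
  (forall a j, Rbar a j = (al j == a)%:R) ->
  (forall a i b, Q a i b = (be a b == i)%:R * w a b) ->
  cond_embedding Rbar Q = refine_mx.
Proof.
move=> RE QE; apply/funext => K; apply/matrixP => j b; rewrite !mxE.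
rewrite (bigD1 (al j)) //= big1 => [|a /negPf na]; last first.
  by rewrite !mxE RE eq_sym na mul0r.
rewrite !mxE RE eqxx mul1r addr0.
rewrite (bigD1 (be (al j) b)) //= big1 => [|i /negPf ni]; last first.
  by rewrite QE eq_sym ni mul0r mulr0.
by rewrite QE eqxx mul1r addr0.
Qed.

(** [refine_mx] is linear, so its difference quotients are constant. *)
Lemma derive_refine_mx (K u : 'M[R]_(k, m)) : 'D_u refine_mx K = refine_mx u.
Proof.
apply: cvg_lim; first exact: norm_hausdorff.
apply: cvg_near_cst; near=> h.
have h0 : h != 0 by near: h; exact: nbhs_dnbhs_neq.
apply/matrixP => i j; rewrite !mxE.
by field.
Unshelve. all: by end_near. Qed.

Lemma mulmx_refine_row (rho : 'rV[R]_k) (S : 'M[R]_(k, l)) :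
  (forall a j, S a j = (al j == a)%:R * s j) -> rho *m S = refine_row rho.
Proof.
move=> SE; apply/rowP => j; rewrite !mxE.
rewrite (bigD1 (al j)) //= big1 => [|a /negPf na]; last first.
  by rewrite SE eq_sym na mul0r mulr0.
by rewrite SE eqxx mul1r addr0.
Qed.

Hypothesis al_s : fibre_weights al s.
Hypothesis be_w : forall a, fibre_weights (be a) (w a).

Lemma tangent_refine_mx u : tangent u -> tangent (refine_mx u).
Proof.
move=> tu j; rewrite -[RHS](tu (al j)) -[RHS](sum_fibres _ (be_w (al j))).
by apply: eq_bigr => b _; rewrite mxE.
Qed.

Lemma fisher_refine_mx rho K u v :
  fisher (refine_row rho) (refine_mx K) (refine_mx u) (refine_mx v) =
  fisher rho K u v.
Proof.
rewrite /fisher -[RHS](sum_fibres _ al_s);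
  apply: eq_bigr => j _.
rewrite mxE mulrAC; congr (_ * _ * _).
rewrite -[RHS](sum_fibres _ (be_w (al j))); apply: eq_bigr => b _; rewrite !mxE.
have w0 : w (al j) b != 0 by rewrite gt_eqF //; case: (be_w (al j)).
(* Once the inverse of the entry of [K] is abstracted, [w] is the only denominator left, and [w0]
   covers it. *)
by rewrite invfM; move: (K _ _)^-1 => Kinv; field.
Qed.

(** Recasts invariance in terms of index maps and weights, so that later arguments only have to
    choose these. *)
Lemma invariant_refine_mx g : invariant_family g ->
  forall rho, (1 <= k)%N -> (2 <= m)%N -> open_simplex k rho ->
  eq_metric (g k m rho)
    (fun K u v =>
      g l n (refine_row rho) (refine_mx K) (refine_mx u) (refine_mx v)).
Proof.
move=> ginv rho k1 m2 rho1 K u v PK tu tv.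
pose Rbar : 'M[R]_(k, l) := \matrix_(a, j) (al j == a)%:R.
pose S : 'M[R]_(k, l) := \matrix_(a, j) ((al j == a)%:R * s j).
pose Q a : 'M[R]_(m, n) := \matrix_(i, b) ((be a b == i)%:R * w a b).
have SE a j : S a j = (al j == a)%:R * s j by rewrite mxE.
have part_S : stochastic_partition_mx S.
  by apply/stochastic_partition_mxP; exists al, s.
have [s0 _] := al_s.
have RS : same_block_structure S Rbar.
  apply/matrixP => a j; rewrite !mxE mulf_eq0 (gt_eqF (s0 j)) orbF.
  by case: (al j == a); rewrite ?oner_eq0 ?eqxx.
have part_R : partition_indicator_mx Rbar.
  exists (fun a => [set j | al j == a]%SET); split=> [|a j].
    exact: indexed_partition_fibres al_s.
  by rewrite mxE inE.
have part_Q a : stochastic_partition_mx (Q a).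
  apply/stochastic_partition_mxP; exists (be a), (w a); split=> // i b.
  by rewrite mxE.
rewrite (ginv _ _ _ _ _ _ _ _ k1 m2 rho1 part_R part_Q part_S RS K u v) //.
rewrite /pullback (mulmx_refine_row _ SE) (@cond_embeddingE Rbar Q).
- by rewrite !derive_refine_mx.
- by move=> a j; rewrite mxE.
- by move=> a i b; rewrite mxE.
Qed.

End Refinement.

Lemma fisher_invariant :
  invariant_family (fun (k m : nat) (rho : 'rV[R]_k) => @fisher R k m rho).
Proof.
move=> k m l n rho Rbar S Q _ _ _ _ part_Q.
move=> /stochastic_partition_mxP[al [s [al_s SE]]] RS K u v _ _ _.
have /choice[be /choice[w bw]] : forall a, exists be_a w_a,
    fibre_weights be_a w_a /\ forall i j, Q a i j = (be_a j == i)%:R * w_a j.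
  by move=> a; apply/stochastic_partition_mxP.
have [s0 _] := al_s.
rewrite /pullback (mulmx_refine_row _ SE).
rewrite (@cond_embeddingE _ _ _ _ al be w).
- by rewrite !derive_refine_mx fisher_refine_mx // => a; case: (bw a).
- move=> a j; rewrite RS mxE SE mulf_eq0 (gt_eqF (s0 j)) orbF.
  by case: (al j == a); rewrite ?oner_eq0 ?eqxx.
- by move=> a; case: (bw a).
Qed.

End Embeddings.

(** * Bilinear forms on tangent matrices invariant under row and entry permutations *)

Section InvariantForms.
Set Implicit Arguments.
Unset Strict Implicit.
Variables (R : realType) (k m : nat).

(** The refinement given by permutations with unit weights; [p] is indexed by the source row
    [t i]. *)
Definition permute (t : {perm 'I_k}) (p : 'I_k -> {perm 'I_m})
  (u : 'M[R]_(k, m)) : 'M[R]_(k, m) := \matrix_(i, j) u (t i) (p (t i) j).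

(** The orthogonal projection of a matrix unit onto the tangent matrices: row [a] has its mean
    subtracted. *)
Definition centred_delta (a : 'I_k) (b : 'I_m) : 'M[R]_(k, m) :=
  \matrix_(i, j) ((i == a)%:R * ((j == b)%:R - m%:R^-1)).

Lemma tangent_centred_delta a b : tangent (centred_delta a b).
Proof.
move=> i; under eq_bigr do rewrite mxE.
rewrite -mulr_sumr big_split /= sumr_const card_ord.
rewrite (bigD1 b) //= eqxx big1 ?addr0 => [|j /negPf -> //].
have m0 : (m%:R : R) != 0 by rewrite pnatr_eq0; case: m b => [[]|].
by rewrite mulNrn -[_ *+ m]mulr_natl mulfV // subrr mulr0.
Qed.

Lemma permute_centred_delta t p a b :
  permute t p (centred_delta (t a) (p (t a) b)) = centred_delta a b.
Proof.
apply/matrixP => i j; rewrite !mxE (inj_eq perm_inj).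
by case: eqVneq => [->|_]; rewrite ?mul0r // (inj_eq perm_inj).
Qed.

(** Centring the matrix units subtracts multiples of the row sums of [u], which vanish. *)
Lemma tangent_centred_delta_sum (u : 'M[R]_(k, m)) : tangent u ->
  u = \sum_(x : 'I_k * 'I_m) u x.1 x.2 *: centred_delta x.1 x.2.
Proof.
move=> tu; apply/matrixP => i j; rewrite summxE.
under eq_bigr do rewrite !mxE.
rewrite -(pair_bigA _ (fun a b =>
  u a b * ((i == a)%:R * ((j == b)%:R - m%:R^-1)))) /=.
rewrite (bigD1 i) //= [X in _ + X]big1 ?addr0 => [|a /negPf na]; last first.
  by apply: big1 => b _; rewrite eq_sym na mul0r mulr0.
under eq_bigr do rewrite eqxx mul1r mulrBr.
rewrite sumrB -mulr_suml tu mul0r subr0 (bigD1 j) //= eqxx mulr1.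
by rewrite big1 ?addr0 // => b /negPf nb; rewrite eq_sym nb mulr0.
Qed.

Lemma tangent0 : tangent (0 : 'M[R]_(k, m)).
Proof. by move=> a; rewrite big1 // => b _; rewrite mxE. Qed.

Lemma tangentD c (u v : 'M[R]_(k, m)) :
  tangent u -> tangent v -> tangent (c *: u + v).
Proof.
move=> tu tv a; under eq_bigr do rewrite !mxE.
by rewrite big_split /= -mulr_sumr tu tv mulr0 addr0.
Qed.

Variable B : 'M[R]_(k, m) -> 'M[R]_(k, m) -> R.
Hypothesis B_linear : forall c u1 u2 v, tangent u1 -> tangent u2 -> tangent v ->
  B (c *: u1 + u2) v = c * B u1 v + B u2 v.

Lemma form_sum (I : Type) (r : seq I) (c : I -> R) (w : I -> 'M[R]_(k, m)) v :
  (forall i, tangent (w i)) -> tangent v ->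
  B (\sum_(i <- r) c i *: w i) v = \sum_(i <- r) c i * B (w i) v.
Proof.
move=> tw tv.
have B0 : B 0 v = 0.
  have := B_linear 1 tangent0 tangent0 tv.
  by rewrite scale1r addr0 mul1r -[LHS]addr0 => /addrI.
(* Linearity is available for tangent arguments only, so the induction also carries tangency of the
   partial sums. *)
suff : tangent (\sum_(i <- r) c i *: w i) /\
  B (\sum_(i <- r) c i *: w i) v = \sum_(i <- r) c i * B (w i) v by case.
elim: r => [|i r [tr IH]].
  by rewrite !big_nil; split; first exact: tangent0.
by rewrite !big_cons B_linear // IH; split=> //; apply: tangentD.
Qed.

Hypothesis B_sym : forall u v, tangent u -> tangent v -> B u v = B v u.
Hypothesis B_permute : forall t p u v, tangent u -> tangent v ->
  B (permute t p u) (permute t p v) = B u v.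

(** [s] sends [b0] to [b]; the second transposition then moves [s b1] to [b'] and fixes [b], which
    differs from both. *)
Lemma two_transitive (b0 b1 b b' : 'I_m) : b1 != b0 -> b' != b ->
  exists t : {perm 'I_m}, t b0 = b /\ t b1 = b'.
Proof.
move=> n1 n2; pose s := tperm b0 b; exists (s * tperm (s b1) b')%g.
rewrite !permM tpermL tpermD ?tpermL // /s ?tpermL //.
by rewrite -[X in _ != X](tpermL b0) (inj_eq perm_inj).
Qed.

(* Write [e a b] for [centred_delta a b].  Independent permutations of two rows
   [a != a'] make [B (e a b) (e a' b')] independent of [b, b'], so it is
   annihilated by vectors of sum zero; within one row, two-transitivity leaves a
   diagonal and an off-diagonal constant. *)
Lemma invariant_form : (2 <= m)%N -> exists c, forall u v,
  tangent u -> tangent v -> B u v = c * \sum_a \sum_b u a b * v a b.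
Proof.
move=> m2.
(* Without rows, the expansion over centred deltas is empty and the form vanishes. *)
have [a0|k0] := pickP 'I_k; last first.
  exists 0 => u v tu tv; rewrite mul0r.
  rewrite (tangent_centred_delta_sum tu) form_sum //.
    by apply: big1 => -[a]; have := k0 a.
  by move=> x; exact: tangent_centred_delta.
move=> _; pose b0 : 'I_m := Ordinal (ltnW m2); pose b1 : 'I_m := Ordinal m2.
have b10 : b1 != b0 by [].
pose e := centred_delta; pose be a b a' b' := B (e a b) (e a' b').
have te a b : tangent (e a b) by exact: tangent_centred_delta.
have beP (t : {perm 'I_k}) (p : 'I_k -> {perm 'I_m}) a b a' b' :
    be a b a' b' = be (t a) (p (t a) b) (t a') (p (t a') b').
  by rewrite /be -[RHS](B_permute t p) // /e !permute_centred_delta.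
(* [q] collects the values independent of the column indices; [c] is the diagonal minus the
   off-diagonal value within a row, the same for every row by transitivity on rows. *)
pose q a a' := if a == a' then be a0 b0 a0 b1 else be a b0 a' b0.
pose c := be a0 b0 a0 b0 - be a0 b0 a0 b1.
have beE a b a' b' : be a b a' b' = q a a' + (a == a')%:R * ((b == b')%:R * c).
  rewrite /q; case: eqVneq => [<-|na]; last first.
    rewrite mul0r addr0.
    rewrite (beP 1%g (fun i => if i == a then tperm b b0 else tperm b' b0)).
    by rewrite !perm1 eqxx eq_sym (negPf na) !tpermL.
  rewrite mul1r; case: (eqVneq b b') => [<-|nb].
    rewrite mul1r (beP (tperm a a0) (fun=> tperm b b0)) !tpermL /c; ring.
  rewrite eq_sym in nb; have [t [t0 t1]] := two_transitive b10 nb.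
  rewrite mul0r addr0 [RHS](beP (tperm a0 a) (fun=> t)) !tpermL t0 t1 //.
clearbody c; exists c => u v tu tv.
have Bu : B u v =
    \sum_a \sum_b \sum_a' \sum_b' u a b * (v a' b' * be a b a' b').
  rewrite {1}(tangent_centred_delta_sum tu) form_sum // pair_big /=.
  apply: eq_bigr => x _; rewrite pair_big /= -mulr_sumr; congr (_ * _).
  (* Symmetry transfers linearity to the second argument. *)
  rewrite B_sym // {1}(tangent_centred_delta_sum tv) form_sum //.
  by apply: eq_bigr => y _; rewrite B_sym.
rewrite Bu mulr_sumr; apply: eq_bigr => a _; rewrite exchange_big /=.
rewrite (bigD1 a) //= [X in _ + X]big1 ?addr0 => [|a' na].
  rewrite mulr_sumr; apply: eq_bigr => b _.
  under eq_bigr => b' _ do rewrite beE eqxx mul1r !mulrDr.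
  rewrite big_split /= -!mulr_sumr -mulr_suml tv mul0r mulr0 add0r.
  rewrite (bigD1 b) //= eqxx big1 ?addr0 => [|b' /negPf nb]; last first.
    by rewrite eq_sym nb mul0r !mulr0.
  rewrite mul1r; ring.
apply: big1 => b _; rewrite eq_sym in na.
under eq_bigr => b' _ do rewrite beE (negPf na) mul0r addr0.
by rewrite -mulr_sumr -mulr_suml tv mul0r mulr0.
Qed.

End InvariantForms.

(** * Rational approximation of positive probability vectors, and passage to the limit *)

Section RationalApproximation.
Set Implicit Arguments.
Unset Strict Implicit.
Variable R : realType.

(** Rounding each [N * x i] up gives positive numerators; the denominator [N + m] leaves room for
    one extra unit per index. *)
Lemma rational_approximation (m : nat) (x : 'I_m -> R) :
  (forall i, 0 < x i) -> \sum_i x i = 1 ->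
  exists q : nat -> 'I_m -> nat, [/\ forall N i, (0 < q N i)%N,
    forall N, (\sum_i q N i = N + m)%N &
    forall i, (q N i)%:R / (N + m)%:R @[N --> \oo] --> x i].
Proof.
move=> x0 x1; have [i0 _|none] := pickP 'I_m; last first.
  by have /eqP := x1; rewrite big_pred0 // eq_sym oner_eq0.
pose t N i := Num.truncn (N%:R * x i).
have tP N i : (t N i)%:R <= N%:R * x i < (t N i).+1%:R.
  by apply: truncn_itv; rewrite mulr_ge0 ?ler0n // ltW.
have sumNx N : \sum_i N%:R * x i = N%:R :> R by rewrite -mulr_sumr x1 mulr1.
have tN N : (\sum_i t N i <= N)%N.
  rewrite -(ler_nat R) natr_sum -[leRHS]sumNx ler_sum // => i _.
  by case/andP: (tP N i).
have Nt N : (N <= \sum_i t N i + m)%N.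
  rewrite -(ler_nat R) -[leLHS]sumNx natrD natr_sum.
  have -> : m%:R = \sum_(i < m) 1 :> R by rewrite sumr_const card_ord.
  rewrite -big_split ler_sum //= => i _.
  by case/andP: (tP N i) => _ /ltW; rewrite -natr1.
(* The numerators [t N i + 1] sum to at most [N + m]; index [i0] receives the
   deficit [d N <= m]. *)
pose d N := (N - \sum_i t N i)%N.
pose q N i := ((t N i).+1 + (i == i0) * d N)%N.
have qE N : (\sum_i q N i = N + m)%N.
  rewrite /q big_split /= -big_distrl /= [X in (_ + X * _)%N](bigD1 i0) //= eqxx
    [X in (_ + (_ + X) * _)%N]big1 => [|i /negPf -> //].
  under eq_bigr do rewrite -addn1.
  rewrite big_split /= sum1_card card_ord addn0 mul1n addnAC /d subnKC //.
exists q; split=> // i.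
(* The numerator exceeds [N * x i] by at most [1 + m]; a further [m] allows for the denominator
   being [N + m] instead of [N]. *)
pose c : R := (1 + m + m)%:R.
apply: (@squeeze_cvgr _ _ _ _ (fun N => x i - c * harmonic N)
                              (fun N => x i + c * harmonic N)).
- near=> N; apply/andP.
  have s0 : 0 < (N + m)%:R :> R.
    by rewrite ltr0n addn_gt0 (leq_ltn_trans _ (ltn_ord i0)) ?orbT.
  have xi1 : x i <= 1.
    by rewrite -x1 (bigD1 i) //= lerDl sumr_ge0 // => j _; exact: ltW.
  have [tl tu] := andP (tP N i).
  have lo : N%:R * x i <= (q N i)%:R.
    apply: le_trans (ltW tu) _; rewrite (ler_nat R) /q leq_addr //.
  have hi : (q N i)%:R <= N%:R * x i + (1 + m)%:R.
    apply: (@le_trans _ _ ((t N i)%:R + (1 + m)%:R)); last by rewrite lerD2r.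
    rewrite -natrD (ler_nat R) /q -addn1 -addnA leq_add2l leq_add2l.
    apply: (@leq_trans (d N)); first by case: (i == i0); rewrite ?mul1n.
    by rewrite /d leq_subLR Nt.
  (* [harmonic N] is the inverse of [N + 1], and [m] is at least one because an index exists. *)
  have h1 : (N + m)%:R^-1 <= N.+1%:R^-1 :> R.
    rewrite lef_pV2 ?posrE // (ler_nat R) -addn1 leq_add2l.
    by rewrite (leq_ltn_trans _ (ltn_ord i0)).
  have c0 : 0 <= c by [].
  have h2 : c / (N + m)%:R <= c * harmonic N by rewrite ler_wpM2l.
  have m0 : 0 <= m%:R :> R by [].
  have xi0 := x0 i.
  have mx0 : 0 <= m%:R * x i by rewrite mulr_ge0 // ltW.
  have mx1 : m%:R * x i <= m%:R by rewrite ler_piMr.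
  have E : c = 1 + m%:R + m%:R by rewrite /c !natrD.
  split.
  + apply: (@le_trans _ _ (x i - c / (N + m)%:R)); first lra.
    rewrite ler_pdivlMr // mulrBl divfK ?gt_eqF // natrD mulrDr.
    rewrite mulrC in lo; lra.
  + apply: (@le_trans _ _ (x i + c / (N + m)%:R)); last lra.
    rewrite ler_pdivrMr // mulrDl divfK ?gt_eqF // [in leRHS]natrD mulrDr.
    rewrite natrD in hi; lra.
- rewrite -[X in _ --> X]subr0 -[X in _ - X](mulr0 c).
  apply: cvgB; first exact: cvg_cst.
  by apply: cvgM; [exact: cvg_cst|exact: cvg_harmonic].
- rewrite -[X in _ --> X]addr0 -[X in _ + X](mulr0 c).
  apply: cvgD; first exact: cvg_cst.
  by apply: cvgM; [exact: cvg_cst|exact: cvg_harmonic].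
Unshelve. all: by end_near. Qed.

(** A neighbourhood of a matrix is controlled by finitely many entries, so entrywise convergence is
    convergence of matrices. *)
Lemma cvg_within_mx (k m : nat) (D : set 'M[R]_(k, m)) (f : 'M[R]_(k, m) -> R)
    (M : nat -> 'M[R]_(k, m)) (L : 'M[R]_(k, m)) :
  {within D, continuous f} -> D L -> (forall n, D (M n)) ->
  (forall i j, M n i j @[n --> \oo] --> L i j) ->
  f (M n) @[n --> \oo] --> f L.
Proof.
move=> /subspace_continuousP/(_ L) fc DL DM ML.
have ML' : M @ \oo --> L.
  move=> A [P LP PA]; rewrite nbhs_filterE /=.
  have : \forall n \near \oo, forall x : 'I_k * 'I_m, P x.1 x.2 (M n x.1 x.2).
    apply: filter_forall => -[i j] /=; exact: (ML i j _ (LP i j)).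
  by apply: filterS => n Pn; apply: PA => i j; exact: (Pn (i, j)).
apply: (cvg_comp _ _ _ (fc DL)) => A /ML'.
by apply: (@filterS _ \oo) => n; apply; exact: DM.
Qed.

Lemma within_mx_limit_eq (k m : nat) (D : set 'M[R]_(k, m)) c
    (f h : 'M[R]_(k, m) -> R) (M : nat -> 'M[R]_(k, m)) (L : 'M[R]_(k, m)) :
  {within D, continuous f} -> {within D, continuous h} ->
  D L -> (forall n, D (M n)) ->
  (forall i j, M n i j @[n --> \oo] --> L i j) ->
  (forall n, f (M n) = c * h (M n)) -> f L = c * h L.
Proof.
move=> fc hc DL DM ML fh.
have fL := cvg_within_mx fc DL DM ML.
have hL : c * h (M n) @[n --> \oo] --> c * h L.
  by apply: cvgM; [exact: cvg_cst|exact: cvg_within_mx hc DL DM ML].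
apply: (cvg_unique _ fL); first exact: norm_hausdorff.
by rewrite (_ : (fun n => c * h (M n)) = (fun n => f (M n))) in hL;
  last exact/funext.
Qed.

End RationalApproximation.

(** * Uniform points, their refinements, and rational points *)

Section UniformPoints.
Set Implicit Arguments.
Unset Strict Implicit.
Variable R : realType.

(** Enumerate the disjoint union of [p a] points over each [a], which has [l] elements, and read off
    the tag. *)
Lemma fibres_of_card (k l : nat) (p : 'I_k -> nat) :
  (\sum_a p a = l)%N ->
  exists h : 'I_l -> 'I_k, forall a, #|[pred j | h j == a]| = p a.
Proof.
move=> pl; pose T := {a : 'I_k & 'I_(p a)}.
have cardT : l = #|{: T}|.
  rewrite card_tagged sumnE big_map big_enum -pl /=.
  by apply: eq_bigr => a _; rewrite card_ord.
exists (fun j => tag (enum_val (cast_ord cardT j))) => a.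
rewrite -sum1_card.
rewrite (reindex (fun x : T => cast_ord (esym cardT) (enum_rank x))) /=.
  rewrite (eq_bigl (fun x : T => (tag x == a) && true)); last first.
    by move=> x; rewrite inE cast_ordKV enum_rankK andbT.
  rewrite -(sig_big_dep (fun b => b == a) (fun _ _ => true)
    (fun _ _ => 1%N)) /=.
  by rewrite big_pred1_eq sum1_card card_ord.
exists (fun j => enum_val (cast_ord cardT j)) => x _.
  by rewrite cast_ordKV enum_rankK.
by rewrite enum_valK cast_ordK.
Qed.

Lemma fibre_weights_card (k l : nat) (p : 'I_k -> nat) (h : 'I_l -> 'I_k) :
  (forall a, 0 < p a)%N -> (forall a, #|[pred j | h j == a]| = p a) ->
  fibre_weights h (fun j => (p (h j))%:R^-1 : R).
Proof.
move=> p0 hp; split=> [j|a]; first by rewrite invr_gt0 ltr0n.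
under eq_bigr => j /eqP hj do rewrite hj.
rewrite sumr_const -[_ *+ _]mulr_natl.
have -> : #|[pred j | h j == a]| = p a by exact: hp.
by rewrite mulfV // pnatr_eq0 -lt0n.
Qed.

Definition uniform_row k : 'rV[R]_k := const_mx k%:R^-1.
Definition uniform_mx k m : 'M[R]_(k, m) := const_mx m%:R^-1.

Lemma uniform_row_simplex k : (1 <= k)%N -> open_simplex k (uniform_row k).
Proof.
move=> k1; split=> [a|]; first by rewrite mxE invr_gt0 ltr0n.
under eq_bigr do rewrite mxE.
by rewrite sumr_const card_ord -[_ *+ _]mulr_natl mulfV // pnatr_eq0 -lt0n.
Qed.

Lemma uniform_mx_polytope k m : (1 <= m)%N ->
  open_cond_polytope k m (uniform_mx k m).
Proof.
move=> m1; split=> [a b|a]; first by rewrite mxE invr_gt0 ltr0n.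
under eq_bigr do rewrite mxE.
by rewrite sumr_const card_ord -[_ *+ _]mulr_natl mulfV // pnatr_eq0 -lt0n.
Qed.

Variable g : forall k m : nat, 'rV[R]_k -> tensor R k m.
Arguments g : clear implicits.
Hypothesis g_riemannian : forall (k m : nat) (rho : 'rV[R]_k),
  (1 <= k)%N -> (2 <= m)%N -> open_simplex k rho ->
  riemannian_metric (g k m rho).
Hypothesis g_invariant : invariant_family g.

Definition uniform_scalar k m c := forall u v, tangent u -> tangent v ->
  g k m (uniform_row k) (uniform_mx k m) u v =
  c * fisher (uniform_row k) (uniform_mx k m) u v.

Lemma uniform_scalar_exists k m : (1 <= k)%N -> (2 <= m)%N ->
  exists c, uniform_scalar k m c.
Proof.
move=> k1 m2; have rhoP := uniform_row_simplex k1.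
have PK := uniform_mx_polytope k (ltnW m2).
have [lin sym _ _] := g_riemannian k1 m2 rhoP.
have perm_weights n (t : {perm 'I_n}) : fibre_weights t (fun=> 1 : R).
  split=> // i; rewrite (big_pred1 ((t^-1)%g i)) // => j.
  by rewrite -[RHS](inj_eq (@perm_inj _ t)) permKV.
have g_permute (t : {perm 'I_k}) (p : 'I_k -> {perm 'I_m}) u v :
    tangent u -> tangent v ->
    g k m (uniform_row k) (uniform_mx k m) (permute t p u) (permute t p v) =
    g k m (uniform_row k) (uniform_mx k m) u v.
  move=> tu tv.
  rewrite [RHS](invariant_refine_mx (perm_weights _ t)
    (fun a => perm_weights _ (p a)) g_invariant k1 m2 rhoP PK tu tv).
  have expE w : refine_mx t p (fun _ _ => 1) w = permute t p w.
    by apply/matrixP => i j; rewrite !mxE mulr1.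
  (* The uniform row and the uniform matrix are fixed by all permutations. *)
  rewrite !expE; congr g; apply/matrixP => i j; rewrite !mxE ?mulr1 //.
have [c Bc] := invariant_form (lin _ PK) (sym _ PK) g_permute m2.
(* At the uniform point the Fisher metric is [m / k] times the standard scalar product, whence the
   inverse factor. *)
exists (c * (k%:R / m%:R)) => u v tu tv; rewrite Bc // -mulrA; congr (_ * _).
have k0 : k%:R != 0 :> R by rewrite pnatr_eq0 -lt0n.
have m0 : m%:R != 0 :> R by rewrite pnatr_eq0 -lt0n ltnW.
rewrite mulr_sumr; apply: eq_bigr => a _; rewrite mxE !mulr_sumr.
by apply: eq_bigr => b _; rewrite mxE invrK; field; rewrite k0.
Qed.

(** Splitting [p a / l] into [p a] equal pieces gives [1 / l], and likewise for [q a b / n]. One map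
    [f] transports both metrics, so a proportionality at the uniform point pulls back. *)
Lemma rational_to_uniform (k m l n : nat) (p : 'I_k -> nat)
    (q : 'I_k -> 'I_m -> nat) :
  (1 <= k)%N -> (2 <= m)%N ->
  (forall a, 0 < p a)%N -> (\sum_a p a = l)%N ->
  (forall a b, 0 < q a b)%N -> (forall a, \sum_b q a b = n)%N ->
  let rho := \row_a ((p a)%:R / l%:R) in
  let K := \matrix_(a, b) ((q a b)%:R / n%:R) in
  [/\ open_simplex k rho, open_cond_polytope k m K &
    exists f : 'M[R]_(k, m) -> 'M[R]_(l, n),
      (forall u, tangent u -> tangent (f u)) /\
      forall u v, tangent u -> tangent v ->
        g k m rho K u v = g l n (uniform_row l) (uniform_mx l n) (f u) (f v) /\
        fisher rho K u v =
        fisher (uniform_row l) (uniform_mx l n) (f u) (f v)].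
Proof.
move=> k1 m2 p0 pl q0 qn rho K.
have l0 : (0 < l)%N.
  by rewrite -pl (bigD1 (Ordinal k1)) //= ltn_addr.
have n0 : (0 < n)%N.
  by rewrite -(qn (Ordinal k1)) (bigD1 (Ordinal m2)) //= ltn_addr.
have rhoP : open_simplex k rho.
  split=> [a|]; first by rewrite mxE divr_gt0 ?ltr0n.
  under eq_bigr do rewrite mxE.
  by rewrite -mulr_suml -natr_sum pl mulfV // pnatr_eq0 -lt0n.
have KP : open_cond_polytope k m K.
  split=> [a b|a]; first by rewrite mxE divr_gt0 ?ltr0n.
  under eq_bigr do rewrite mxE.
  by rewrite -mulr_suml -natr_sum qn mulfV // pnatr_eq0 -lt0n.
split=> //.
have [al alp] := fibres_of_card pl.
have /choice[be beq] : forall a, exists h : 'I_n -> 'I_m,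
    forall b, #|[pred j | h j == b]| = q a b.
  by move=> a; exact: fibres_of_card.
have al_s := fibre_weights_card p0 alp.
have be_w a := fibre_weights_card (q0 a) (beq a).
set s := fun j => _ in al_s; pose w a b : R := (q a (be a b))%:R^-1.
have rhoE : refine_row al s rho = uniform_row l.
  apply/rowP => j; rewrite !mxE mulrAC mulfV ?mul1r //.
  by rewrite pnatr_eq0 -lt0n.
have KE : refine_mx al be w K = uniform_mx l n.
  apply/matrixP => j b; rewrite !mxE mulrAC mulfV ?mul1r //.
  by rewrite pnatr_eq0 -lt0n.
exists (refine_mx al be w).
split=> [u|u v tu tv]; first exact: tangent_refine_mx.
split; last by rewrite -(fisher_refine_mx al_s be_w rho K) rhoE KE.
rewrite (invariant_refine_mx al_s be_w g_invariant k1 m2 rhoP KP tu tv).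
by rewrite rhoE KE.
Qed.

(** Supplies a vector whose positive norms let scalars be cancelled and force the constant to be
    positive. *)
Lemma exists_tangent_gt0 k m : (1 <= k)%N -> (2 <= m)%N ->
  exists2 u : 'M[R]_(k, m), tangent u &
    0 < fisher (uniform_row k) (uniform_mx k m) u u /\
    0 < g k m (uniform_row k) (uniform_mx k m) u u.
Proof.
move=> k1 m2; have rhoP := uniform_row_simplex k1.
have PK := uniform_mx_polytope k (ltnW m2).
pose u := centred_delta R (Ordinal k1) (Ordinal m2).
have tu : tangent u by exact: tangent_centred_delta.
have u0 : u != 0.
  (* The delta sits in column 1, so its entry in column 0 is minus the inverse of [m]. *)
  apply/eqP => /matrixP/(_ (Ordinal k1) (Ordinal (ltnW m2)))/eqP.
  by rewrite !mxE eqxx mul1r sub0r oppr_eq0 invr_eq0 pnatr_eq0 gtn_eqF // ltnW.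
exists u => //; split.
  by have [_ _ pos _] := fisher_riemannian m rhoP; exact: pos.
by have [_ _ pos _] := g_riemannian k1 m2 rhoP; exact: pos.
Qed.

(** Equal splitting maps the uniform point to a uniform point, so both scalars multiply the same
    nonzero Fisher norm. *)
Lemma uniform_scalar_refine k m i j c c' :
  (1 <= k)%N -> (2 <= m)%N -> (0 < i)%N -> (0 < j)%N ->
  uniform_scalar k m c -> uniform_scalar (k * i) (m * j) c' -> c = c'.
Proof.
move=> k1 m2 i0 j0 gc gc'.
have pl : (\sum_(a < k) i = k * i)%N by rewrite sum_nat_const card_ord.
have qn (a : 'I_k) : (\sum_(b < m) j = m * j)%N.
  by rewrite sum_nat_const card_ord.
have [_ _ [f [tf fE]]] :=
  rational_to_uniform k1 m2 (fun=> i0) pl (fun _ _ => j0) qn.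
have rhoE : \row_(a < k) (i%:R / (k * i)%:R) = uniform_row k.
  apply/rowP => a; rewrite !mxE natrM invfM mulrCA mulfV ?mulr1 //.
  by rewrite pnatr_eq0 -lt0n.
have KE : \matrix_(a < k, b < m) (j%:R / (m * j)%:R) = uniform_mx k m.
  apply/matrixP => a b; rewrite !mxE natrM invfM mulrCA mulfV ?mulr1 //.
  by rewrite pnatr_eq0 -lt0n.
have [u tu [fu0 _]] := exists_tangent_gt0 k1 m2.
have [] := fE u u tu tu.
rewrite rhoE KE gc // (gc' _ _ (tf _ tu) (tf _ tu)) => + fE'.
by rewrite -fE' => /mulIf; apply; rewrite gt_eqF.
Qed.

Lemma uniform_scalar_constant : exists2 A : R, 0 < A &
  forall k m, (1 <= k)%N -> (2 <= m)%N -> uniform_scalar k m A.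
Proof.
have [A gA] := uniform_scalar_exists (isT : (1 <= 1)%N) (isT : (2 <= 2)%N).
exists A => [|k m k1 m2].
  have [u tu [f0 g0]] :=
    exists_tangent_gt0 (isT : (1 <= 1)%N) (isT : (2 <= 2)%N).
  by move: g0; rewrite gA // pmulr_lgt0.
have [c gc] := uniform_scalar_exists k1 m2.
(* Sizes [(k, m)] and [(1, 2)] have the common refinement [(k, m * 2)]. *)
have [c' gc'] : exists c', uniform_scalar (k * 1) (m * 2) c'.
  apply: uniform_scalar_exists; first by rewrite muln1.
  by rewrite (leq_trans m2) // leq_pmulr.
have cc' : c = c' by exact: uniform_scalar_refine gc gc'.
rewrite -cc' muln1 mulnC in gc'.
rewrite -(mul1n k) in gc'.
by rewrite (uniform_scalar_refine _ _ k1 (ltnW m2) gA gc').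
Qed.

Lemma metric_at_rational A (k m l n : nat) (p : 'I_k -> nat)
    (q : 'I_k -> 'I_m -> nat) u v :
  (forall k m, (1 <= k)%N -> (2 <= m)%N -> uniform_scalar k m A) ->
  (1 <= k)%N -> (2 <= m)%N ->
  (forall a, 0 < p a)%N -> (\sum_a p a = l)%N ->
  (forall a b, 0 < q a b)%N -> (forall a, \sum_b q a b = n)%N ->
  tangent u -> tangent v ->
  let rho := \row_a ((p a)%:R / l%:R) in
  let K := \matrix_(a, b) ((q a b)%:R / n%:R) in
  g k m rho K u v = A * fisher rho K u v.
Proof.
move=> gA k1 m2 p0 pl q0 qn tu tv rho K.
have [_ _ [f [tf /(_ u v tu tv)[-> ->]]]] :=
  rational_to_uniform k1 m2 p0 pl q0 qn.
apply: gA; try exact: tf.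
  by rewrite -pl (bigD1 (Ordinal k1)) //= ltn_addr.
(* Each of the [m] numerators is at least one, so [n] is at least [m], hence at least two. *)
rewrite (leq_trans m2) //.
have -> : m = (\sum_(b < m) 1)%N by rewrite sum1_card card_ord.
by rewrite -(qn (Ordinal k1)) leq_sum.
Qed.

(** * Extension to all points by continuity *)

Hypothesis g_continuous : forall (k m : nat) (K u v : 'M[R]_(k, m)),
  (1 <= k)%N -> (2 <= m)%N ->
  open_cond_polytope k m K -> tangent u -> tangent v ->
  {within open_simplex k, continuous (fun rho => g k m rho K u v)}.

(** Two successive limits, because continuity is available separately in [K] and in [rho]: first in
    [K] at a rational [rho], then in [rho]. *)
Lemma metric_eq_fisher A :
  (forall k m, (1 <= k)%N -> (2 <= m)%N -> uniform_scalar k m A) ->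
  forall (k m : nat) (rho : 'rV[R]_k),
    (1 <= k)%N -> (2 <= m)%N -> open_simplex k rho ->
    eq_metric (g k m rho) (fun K u v => A * fisher rho K u v).
Proof.
move=> gA k m rho k1 m2 rhoP K u v PK tu tv.
have [p [p0 pl p_rho]] := rational_approximation rhoP.1 rhoP.2.
have /choice[q qP] := fun a => rational_approximation (PK.1 a) (PK.2 a).
pose rho_ N : 'rV[R]_k := \row_a ((p N a)%:R / (N + k)%:R).
pose K_ N : 'M[R]_(k, m) := \matrix_(a, b) ((q a N b)%:R / (N + m)%:R).
have q0 N a b : (0 < q a N b)%N by case: (qP a).
have qn N a : (\sum_b q a N b = N + m)%N by case: (qP a).
have rho_P N : open_simplex k (rho_ N).
  by have [] := rational_to_uniform k1 m2 (p0 N) (pl N) (q0 N) (qn N).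
have K_P N : open_cond_polytope k m (K_ N).
  by have [] := rational_to_uniform k1 m2 (p0 N) (pl N) (q0 N) (qn N).
have at_rational N : g k m (rho_ N) K u v = A * fisher (rho_ N) K u v.
  (* For the empty list of directions, smoothness yields continuity in [K]. *)
  have [_ _ _ /(_ u v tu tv [::])[//|gK _]] := g_riemannian k1 m2 (rho_P N).
  have [_ _ _ /(_ u v tu tv [::])[//|fK _]] := fisher_riemannian m (rho_P N).
  apply: (within_mx_limit_eq gK fK PK K_P) => [a b|N'] /=.
    have [_ _ qK] := qP a; under eq_fun do rewrite mxE; exact: qK.
  exact: metric_at_rational.
have fc : {within open_simplex k, continuous (fun rho => fisher rho K u v)}.
  apply: continuous_subspaceT => r; apply: (@cvg_big _ _ _ _ _ _ _ (nbhs r)).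
    exact: add_continuous.
  move=> a _; apply: cvgM; [exact: coord_continuous|exact: cvg_cst].
apply: (within_mx_limit_eq (g_continuous k1 m2 PK tu tv) fc rhoP rho_P) => //.
by move=> i a; rewrite ord1; under eq_fun do rewrite mxE; exact: p_rho.
Qed.

End UniformPoints.

Theorem theorem17 (R : realType) :
  invariant_family (fun (k m : nat) (rho : 'rV[R]_k) => @fisher R k m rho)
  /\
  (forall g : forall k m : nat, 'rV[R]_k -> tensor R k m,
     (forall (k m : nat) (rho : 'rV[R]_k),
        (1 <= k)%N -> (2 <= m)%N -> open_simplex k rho ->
        riemannian_metric (g k m rho)) ->
     invariant_family g ->
     (forall (k m : nat) (K u v : 'M[R]_(k, m)),
        (1 <= k)%N -> (2 <= m)%N ->
        open_cond_polytope k m K -> tangent u -> tangent v ->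
        {within open_simplex k, continuous (fun rho => g k m rho K u v)}) ->
     exists A : R, 0 < A /\
       forall (k m : nat) (rho : 'rV[R]_k),
         (1 <= k)%N -> (2 <= m)%N -> open_simplex k rho ->
         eq_metric (g k m rho)
           (fun K u v => A * fisher rho K u v)).
Proof.
split; first exact: fisher_invariant.
move=> g g_riem g_inv g_cont.
have [A A0 gA] := uniform_scalar_constant g_riem g_inv.
by exists A; split=> //; exact: metric_eq_fisher.
Qed.
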